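(* Let $\mathcal{C}$ be a monoidal category, let $H$ and $L$ be braided bialgebras in $\mathcal{C}$ with braids $c_H\colon H\otimes H\to H\otimes H$ and $c_L\colon L\otimes L\to L\otimes L$, and let $c_{LH}\colon L\otimes H\to H\otimes L$ be an invertible arrow. Suppose that $$(c_{LH}\otimes L)\circ (L\otimes c_{LH})\circ (c_L\otimes H)=(H\otimes c_L)\circ (c_{LH}\otimes L)\circ (L\otimes c_{LH}),$$ $$(c_H\otimes L)\circ (H\otimes c_{LH})\circ (c_{LH}\otimes H)=(H\otimes c_{LH})\circ (c_{LH}\otimes H)\circ (L\otimes c_H),$$ and that $c_{LH}$ is compatible with the algebra and coalgebra structures of $H$ and of $L$. Then $H\otimes L$ is a braided bialgebra in $\mathcal{C}$ via - multiplication $\mu_{H\otimes L}=(\mu_H\otimes\mu_L)\circ (H\otimes c_{LH}\otimes L)$, - unit $\eta_{H\otimes L}=\eta_H\otimes\eta_L$, - comultiplication $\Delta_{H\otimes L}=(H\otimes c_{LH}^{-1}\otimes L)\circ(\Delta_H\otimes\Delta_L)$, - counit $\varepsilon_{H\otimes L}=\varepsilon_H\otimes\varepsilon_L$, - braid $c_{H\otimes L}=(H\otimes c_{LH}^{-1}\otimes L)\circ(c_H\otimes c_L)\circ(H\otimes c_{LH}\otimes L)$. Moreover, if $H$ and $L$ are braided Hopf algebras with antipodes $S_H$ and $S_L$, then $H\otimes L$ with this structure is a braided Hopf algebra with antipode $S_{H\otimes L}=S_H\otimes S_L$.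
   Context: Conventions. $\mathcal{C}$ is a monoidal category with tensor product $\otimes$ and unit object $I$; associativity and unit constraints are suppressed. An object's name also denotes its identity arrow (so $H\otimes c$ means $\mathrm{id}_H\otimes c$). Algebras in $\mathcal{C}$ are associative and unital, with multiplication $\mu$ and unit $\eta\colon I\to A$; coalgebras are coassociative and counital, with comultiplication $\Delta$ and counit $\varepsilon\colon C\to I$. Compatibility. Let $c\colon V\otimes W\to W\otimes V$ be an arrow in $\mathcal{C}$. - If $V$ is an algebra, $c$ is compatible with the algebra structure of $V$ if $c\circ(\eta\otimes W)=W\otimes\eta$ and $c\circ(\mu\otimes W)=(W\otimes\mu)\circ(c\otimes V)\circ(V\otimes c)$. - If $V$ is a coalgebra, $c$ is compatible with the coalgebra structure of $V$ if $(W\otimes\varepsilon)\circ c=\varepsilon\otimes W$ and $(W\otimes\Delta)\circ c=(c\otimes V)\circ(V\otimes c)\circ(\Delta\otimes W)$. - If $W$ is an algebra, $c$ is compatible with the algebra structure of $W$ if $c\circ(V\otimes\eta)=\eta\otimes V$ and $c\circ(V\otimes\mu)=(\mu\otimes V)\circ(W\otimes c)\circ(c\otimes W)$. - If $W$ is a coalgebra, $c$ is compatible with the coalgebra structure of $W$ if $(\varepsilon\otimes V)\circ c=V\otimes\varepsilon$ and $(\Delta\otimes V)\circ c=(W\otimes c)\circ(c\otimes W)\circ(V\otimes\Delta)$. Braided bialgebra. A braided bialgebra in $\mathcal{C}$ is an object $H$ with an algebra structure, a coalgebra structure and an isomorphism $c_H\colon H\otimes H\to H\otimes H$ (the braid of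 $H$) such that: - $(c_H\otimes H)\circ(H\otimes c_H)\circ(c_H\otimes H)=(H\otimes c_H)\circ(c_H\otimes H)\circ(H\otimes c_H)$ (Braid Equation); - $c_H$ is compatible with the algebra and coalgebra structures of $H$ (in both the first and the second tensor factor); - $\eta$ is a coalgebra morphism and $\varepsilon$ is an algebra morphism (where $I$ has its canonical algebra and coalgebra structures); - $\Delta\circ\mu=(\mu\otimes\mu)\circ(H\otimes c_H\otimes H)\circ(\Delta\otimes\Delta)$. Braided Hopf algebra. A braided bialgebra $H$ is a braided Hopf algebra if there is an arrow $S\colon H\to H$ (the antipode) which is the inverse of the identity of $H$ in the monoid $\mathrm{Hom}_{\mathcal{C}}(H,H)$ with convolution product $f*g=\mu\circ(f\otimes g)\circ\Delta$ and unit $\eta\circ\varepsilon$. *)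

(* Defs.v *)
Set Implicit Arguments.
Unset Strict Implicit.
Unset Printing Implicit Defensive.

Declare Scope monoidal_scope.
Delimit Scope monoidal_scope with monoidal.
Open Scope monoidal_scope.

Record category : Type := Category {
  ob :> Type;
  hom : ob -> ob -> Type;
  id : forall A : ob, hom A A;
  comp : forall A B C : ob, hom B C -> hom A B -> hom A C;
  comp_id_l : forall (A B : ob) (f : hom A B), comp (id B) f = f;
  comp_id_r : forall (A B : ob) (f : hom A B), comp f (id A) = f;
  comp_assoc : forall (A B C D : ob) (h : hom C D) (g : hom B C) (f : hom A B),
    comp h (comp g f) = comp (comp h g) f
}.

Arguments hom {c} A B.
Arguments id {c} A.
Arguments comp {c A B C} g f.

Notation "g ∘ f" := (comp g f) (at level 40, left associativity)
  : monoidal_scope.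

Record iso (C : category) (A B : C) : Type := Iso {
  iso_hom :> hom A B;
  iso_inv : hom B A;
  iso_homK : iso_inv ∘ iso_hom = id A;
  iso_invK : iso_hom ∘ iso_inv = id B
}.

Notation "f ⁻¹" := (iso_inv f) (at level 1, format "f ⁻¹") : monoidal_scope.

Definition is_iso (C : category) (A B : C) (f : hom A B) : Prop :=
  exists g : hom B A, g ∘ f = id A /\ f ∘ g = id B.

(* Not assumed strict: the associativity and unit constraints are explicit,
   with [assoc : (A ⊗ B) ⊗ C -> A ⊗ (B ⊗ C)], [lunit : I ⊗ A -> A] and
   [runit : A ⊗ I -> A]. *)
Record monoidal_category : Type := MonoidalCategory {
  mcat :> category;
  tensor : mcat -> mcat -> mcat;
  tensor_hom : forall A A' B B' : mcat,
    hom A A' -> hom B B' -> hom (tensor A B) (tensor A' B');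
  tensor_id : forall A B : mcat,
    tensor_hom (id A) (id B) = id (tensor A B);
  tensor_comp : forall (A A' A'' B B' B'' : mcat)
    (f' : hom A' A'') (f : hom A A') (g' : hom B' B'') (g : hom B B'),
    tensor_hom (f' ∘ f) (g' ∘ g) = tensor_hom f' g' ∘ tensor_hom f g;
  munit : mcat;
  assoc : forall A B C : mcat,
    iso (tensor (tensor A B) C) (tensor A (tensor B C));
  lunit : forall A : mcat, iso (tensor munit A) A;
  runit : forall A : mcat, iso (tensor A munit) A;
  assoc_nat : forall (A A' B B' C C' : mcat)
    (f : hom A A') (g : hom B B') (h : hom C C'),
    assoc A' B' C' ∘ tensor_hom (tensor_hom f g) h
    = tensor_hom f (tensor_hom g h) ∘ assoc A B C;
  lunit_nat : forall (A A' : mcat) (f : hom A A'),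
    lunit A' ∘ tensor_hom (id munit) f = f ∘ lunit A;
  runit_nat : forall (A A' : mcat) (f : hom A A'),
    runit A' ∘ tensor_hom f (id munit) = f ∘ runit A;
  pentagon : forall A B C D : mcat,
    tensor_hom (id A) (assoc B C D) ∘ assoc A (tensor B C) D
      ∘ tensor_hom (assoc A B C) (id D)
    = assoc A B (tensor C D) ∘ assoc (tensor A B) C D;
  triangle : forall A B : mcat,
    tensor_hom (id A) (lunit B) ∘ assoc A munit B
    = tensor_hom (runit A) (id B)
}.

Arguments tensor {m} A B.
Arguments tensor_hom {m A A' B B'} f g.
Arguments munit {m}.
Arguments assoc {m A B C}.
Arguments lunit {m A}.
Arguments runit {m A}.

(* [A ◁ f] and [f ▷ A] are the arrows A ⊗ f and f ⊗ A, where the object A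
   stands for its identity arrow. *)
Notation "A ⊗ B" := (tensor A B) (at level 30, right associativity)
  : monoidal_scope.
Notation "f ⊗₁ g" := (tensor_hom f g) (at level 30, right associativity)
  : monoidal_scope.
Notation "A ◁ f" := (tensor_hom (id A) f) (at level 30, right associativity)
  : monoidal_scope.
Notation "f ▷ A" := (tensor_hom f (id A)) (at level 30, right associativity)
  : monoidal_scope.

Section BraidedHopf.

Variable C : monoidal_category.

(* The arrow A ⊗ f ⊗ D, between fourfold products bracketed in pairs. *)
Definition middle (A B B' E E' D : C) (f : hom (B ⊗ E) (E' ⊗ B'))
  : hom ((A ⊗ B) ⊗ (E ⊗ D)) ((A ⊗ E') ⊗ (B' ⊗ D)) :=
  assoc⁻¹ ∘ (A ◁ (assoc ∘ (f ▷ D) ∘ assoc⁻¹)) ∘ assoc.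

Definition is_algebra (A : C) (mu : hom (A ⊗ A) A) (eta : hom munit A)
  : Prop :=
  mu ∘ (mu ▷ A) = mu ∘ (A ◁ mu) ∘ assoc /\
  mu ∘ (eta ▷ A) = lunit /\
  mu ∘ (A ◁ eta) = runit.

Definition is_coalgebra (A : C) (Delta : hom A (A ⊗ A)) (eps : hom A munit)
  : Prop :=
  assoc ∘ (Delta ▷ A) ∘ Delta = (A ◁ Delta) ∘ Delta /\
  lunit ∘ (eps ▷ A) ∘ Delta = id A /\
  runit ∘ (A ◁ eps) ∘ Delta = id A.

Definition is_algebra_morphism (A B : C)
  (muA : hom (A ⊗ A) A) (etaA : hom munit A)
  (muB : hom (B ⊗ B) B) (etaB : hom munit B) (f : hom A B) : Prop :=
  f ∘ muA = muB ∘ (f ⊗₁ f) /\ f ∘ etaA = etaB.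

Definition is_coalgebra_morphism (A B : C)
  (DeltaA : hom A (A ⊗ A)) (epsA : hom A munit)
  (DeltaB : hom B (B ⊗ B)) (epsB : hom B munit) (f : hom A B) : Prop :=
  DeltaB ∘ f = (f ⊗₁ f) ∘ DeltaA /\ epsB ∘ f = epsA.

(* [lunit] and [runit] agree on the unit object, so either one gives its
   canonical algebra and coalgebra structures. *)
Definition unit_mul : hom (@munit C ⊗ munit) munit := lunit.
Definition unit_comul : hom (@munit C) (munit ⊗ munit) := lunit⁻¹.

Definition compat_algebra_l (V W : C) (mu : hom (V ⊗ V) V)
  (eta : hom munit V) (c : hom (V ⊗ W) (W ⊗ V)) : Prop :=
  c ∘ (eta ▷ W) = (W ◁ eta) ∘ runit⁻¹ ∘ lunit /\
  c ∘ (mu ▷ W)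
  = (W ◁ mu) ∘ assoc ∘ (c ▷ V) ∘ assoc⁻¹ ∘ (V ◁ c) ∘ assoc.

Definition compat_coalgebra_l (V W : C) (Delta : hom V (V ⊗ V))
  (eps : hom V munit) (c : hom (V ⊗ W) (W ⊗ V)) : Prop :=
  runit ∘ (W ◁ eps) ∘ c = lunit ∘ (eps ▷ W) /\
  (W ◁ Delta) ∘ c
  = assoc ∘ (c ▷ V) ∘ assoc⁻¹ ∘ (V ◁ c) ∘ assoc ∘ (Delta ▷ W).

Definition compat_algebra_r (V W : C) (mu : hom (W ⊗ W) W)
  (eta : hom munit W) (c : hom (V ⊗ W) (W ⊗ V)) : Prop :=
  c ∘ (V ◁ eta) = (eta ▷ V) ∘ lunit⁻¹ ∘ runit /\
  c ∘ (V ◁ mu)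
  = (mu ▷ V) ∘ assoc⁻¹ ∘ (W ◁ c) ∘ assoc ∘ (c ▷ W) ∘ assoc⁻¹.

Definition compat_coalgebra_r (V W : C) (Delta : hom W (W ⊗ W))
  (eps : hom W munit) (c : hom (V ⊗ W) (W ⊗ V)) : Prop :=
  lunit ∘ (eps ▷ V) ∘ c = runit ∘ (V ◁ eps) /\
  (Delta ▷ V) ∘ c
  = assoc⁻¹ ∘ (W ◁ c) ∘ assoc ∘ (c ▷ W) ∘ assoc⁻¹ ∘ (V ◁ Delta).

Definition braid_equation (A : C) (c : hom (A ⊗ A) (A ⊗ A)) : Prop :=
  (c ▷ A) ∘ assoc⁻¹ ∘ (A ◁ c) ∘ assoc ∘ (c ▷ A)
  = assoc⁻¹ ∘ (A ◁ c) ∘ assoc ∘ (c ▷ A) ∘ assoc⁻¹ ∘ (A ◁ c) ∘ assoc.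

Record is_braided_bialgebra (A : C) (mu : hom (A ⊗ A) A) (eta : hom munit A)
  (Delta : hom A (A ⊗ A)) (eps : hom A munit) (c : hom (A ⊗ A) (A ⊗ A))
  : Prop := IsBraidedBialgebra {
  bb_algebra : is_algebra mu eta;
  bb_coalgebra : is_coalgebra Delta eps;
  bb_braid_iso : is_iso c;
  bb_braid_equation : braid_equation c;
  bb_compat_algebra_l : compat_algebra_l mu eta c;
  bb_compat_coalgebra_l : compat_coalgebra_l Delta eps c;
  bb_compat_algebra_r : compat_algebra_r mu eta c;
  bb_compat_coalgebra_r : compat_coalgebra_r Delta eps c;
  bb_unit : is_coalgebra_morphism unit_comul (id munit) Delta eps eta;
  bb_counit : is_algebra_morphism mu eta unit_mul (id munit) eps;
  bb_comul_mul :
    Delta ∘ mu = (mu ⊗₁ mu) ∘ middle A A c ∘ (Delta ⊗₁ Delta)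
}.

Definition convolution (A : C) (mu : hom (A ⊗ A) A) (Delta : hom A (A ⊗ A))
  (f g : hom A A) : hom A A :=
  mu ∘ (f ⊗₁ g) ∘ Delta.

Definition is_antipode (A : C) (mu : hom (A ⊗ A) A) (eta : hom munit A)
  (Delta : hom A (A ⊗ A)) (eps : hom A munit) (S : hom A A) : Prop :=
  convolution mu Delta S (id A) = eta ∘ eps /\
  convolution mu Delta (id A) S = eta ∘ eps.

Definition is_braided_Hopf_algebra (A : C) (mu : hom (A ⊗ A) A)
  (eta : hom munit A) (Delta : hom A (A ⊗ A)) (eps : hom A munit)
  (c : hom (A ⊗ A) (A ⊗ A)) (S : hom A A) : Prop :=
  is_braided_bialgebra mu eta Delta eps c /\ is_antipode mu eta Delta eps S.

End BraidedHopf.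

Arguments middle {C} A {B B' E E'} D f.

(* Main.v *)
Require Import Defs.

(* Iterating [cLH] gives crossings [L^w ⊗ H^v -> H^v ⊗ L^w] for all bracketed
   words [w] and [v], and from these an isomorphism
   [(H ⊗ L)^w -> H^w ⊗ L^w] which moves all copies of [H] to the left of all
   copies of [L]. The hypotheses on [cLH] say exactly that its crossings are
   natural for every structure arrow of [H] and of [L], and the structure of
   [H ⊗ L] is the one that makes the regrouping isomorphism natural for each
   structure arrow. Hence it is natural for every composite built from them, so
   any equation between such composites that holds in [H] and in [L] holds in
   [H ⊗ L]; each axiom is such an equation. For the antipode one also needs that
   [cLH] commutes with [SH] and [SL], which follows from the uniqueness of
   convolution inverses. *)

Set Implicit Arguments.
Unset Strict Implicit.
Unset Printing Implicit Defensive.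

(** * Isomorphisms in a category: composition, inverses and cancellation *)

Section Iso.
Variable C : category.

Definition iso_id (A : C) : iso A A :=
  Iso (comp_id_l (id A)) (comp_id_l (id A)).

Lemma iso_comp_K (A B D : C) (g : iso B D) (f : iso A B) :
  (f⁻¹ ∘ g⁻¹) ∘ (g ∘ f) = id A.
Proof.
  rewrite comp_assoc, <- (comp_assoc (f⁻¹)), iso_homK, comp_id_r.
  apply iso_homK.
Qed.

Lemma iso_comp_VK (A B D : C) (g : iso B D) (f : iso A B) :
  (g ∘ f) ∘ (f⁻¹ ∘ g⁻¹) = id D.
Proof.
  rewrite comp_assoc, <- (comp_assoc g), iso_invK, comp_id_r.
  apply iso_invK.
Qed.

Definition iso_comp (A B D : C) (g : iso B D) (f : iso A B) : iso A D :=
  Iso (iso_comp_K g f) (iso_comp_VK g f).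

Definition iso_sym (A B : C) (f : iso A B) : iso B A :=
  Iso (iso_invK f) (iso_homK f).

Lemma iso_cancel_l (A B D : C) (i : iso B D) (f g : hom A B) :
  i ∘ f = i ∘ g -> f = g.
Proof.
  intros E; rewrite <- (comp_id_l f), <- (comp_id_l g), <- (iso_homK i).
  now rewrite <- !comp_assoc, E.
Qed.

Lemma iso_cancel_r (A B D : C) (i : iso A B) (f g : hom B D) :
  f ∘ i = g ∘ i -> f = g.
Proof.
  intros E; rewrite <- (comp_id_r f), <- (comp_id_r g), <- (iso_invK i).
  now rewrite !comp_assoc, E.
Qed.

Lemma comp_isoK (A B D : C) (i : iso A B) (f : hom A D) : f ∘ i⁻¹ ∘ i = f.
Proof. now rewrite <- comp_assoc, iso_homK, comp_id_r. Qed.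

Lemma comp_isoVK (A B D : C) (i : iso A B) (f : hom B D) : f ∘ i ∘ i⁻¹ = f.
Proof. now rewrite <- comp_assoc, iso_invK, comp_id_r. Qed.

End Iso.

(** * Strictification *)

Section Coherence.
Variable C : monoidal_category.

Lemma whisker_comp (A B B' B'' : C) (g : hom B' B'') (f : hom B B') :
  A ◁ (g ∘ f) = (A ◁ g) ∘ (A ◁ f).
Proof. now rewrite <- tensor_comp, comp_id_l. Qed.

Lemma comp_whisker (A A' A'' B : C) (g : hom A' A'') (f : hom A A') :
  (g ∘ f) ▷ B = (g ▷ B) ∘ (f ▷ B).
Proof. now rewrite <- tensor_comp, comp_id_l. Qed.

Lemma tensor_split (A A' B B' : C) (f : hom A A') (g : hom B B') :
  f ⊗₁ g = (A' ◁ g) ∘ (f ▷ B).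
Proof. now rewrite <- tensor_comp, comp_id_l, comp_id_r. Qed.

Lemma tensor_split' (A A' B B' : C) (f : hom A A') (g : hom B B') :
  f ⊗₁ g = (f ▷ B') ∘ (A ◁ g).
Proof. now rewrite <- tensor_comp, comp_id_l, comp_id_r. Qed.

Lemma tensor_comp_l (A A' A'' B B' : C) (g : hom A' A'') (f : hom A A')
  (k : hom B B') : (g ∘ f) ⊗₁ k = (g ▷ B') ∘ (f ⊗₁ k).
Proof. now rewrite <- tensor_comp, comp_id_l. Qed.

Lemma tensor_comp_r (A A' B B' B'' : C) (k : hom A A') (g : hom B' B'')
  (f : hom B B') : k ⊗₁ (g ∘ f) = (A' ◁ g) ∘ (k ⊗₁ f).
Proof. now rewrite <- tensor_comp, comp_id_l. Qed.

Lemma iso_tensor_K (A A' B B' : C) (f : iso A A') (g : iso B B') :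
  (f⁻¹ ⊗₁ g⁻¹) ∘ (f ⊗₁ g) = id (A ⊗ B).
Proof. now rewrite <- tensor_comp, !iso_homK, tensor_id. Qed.

Lemma iso_tensor_VK (A A' B B' : C) (f : iso A A') (g : iso B B') :
  (f ⊗₁ g) ∘ (f⁻¹ ⊗₁ g⁻¹) = id (A' ⊗ B').
Proof. now rewrite <- tensor_comp, !iso_invK, tensor_id. Qed.

Definition iso_tensor (A A' B B' : C) (f : iso A A') (g : iso B B') :
  iso (A ⊗ B) (A' ⊗ B') := Iso (iso_tensor_K f g) (iso_tensor_VK f g).

Lemma whisker_unit_inj_l (A B : C) (f g : hom A B) :
  munit ◁ f = munit ◁ g -> f = g.
Proof.
  intros E; apply (iso_cancel_r (i := lunit)).
  now rewrite <- !lunit_nat, E.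
Qed.

Lemma whisker_unit_inj_r (A B : C) (f g : hom A B) :
  f ▷ munit = g ▷ munit -> f = g.
Proof.
  intros E; apply (iso_cancel_r (i := runit)).
  now rewrite <- !runit_nat, E.
Qed.

(* Kelly: the second unit triangle follows from the pentagon and the middle
   triangle, after tensoring with [munit] on the left. *)
Lemma lunit_tensor (A B : C) :
  (@lunit C (A ⊗ B)) ∘ assoc = (@lunit C A) ▷ B.
Proof.
  apply whisker_unit_inj_l; rewrite whisker_comp.
  apply (iso_cancel_r (i := assoc)).
  apply (iso_cancel_r (i := iso_tensor assoc (iso_id B))); cbn.
  rewrite <- (comp_assoc (munit ◁ lunit)), <- (comp_assoc (munit ◁ lunit)).
  rewrite pentagon, comp_assoc, triangle.
  rewrite <- (tensor_id A B), <- assoc_nat, <- triangle.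
  rewrite comp_whisker, comp_assoc.
  now rewrite assoc_nat.
Qed.

Lemma pentagon_comp (A B D E Z : C) (k : hom (A ⊗ B ⊗ D ⊗ E) Z) :
  k ∘ (A ◁ assoc) ∘ assoc ∘ (assoc ▷ E) = k ∘ assoc ∘ assoc.
Proof. now rewrite <- !comp_assoc, <- pentagon, !comp_assoc. Qed.

(** The tensor product is an arbitrary operation on objects, so a bracketing cannot be recovered
    from an object and is kept as data. *)
Inductive bracketing : Type :=
| b_unit : bracketing
| b_leaf : C -> bracketing
| b_tensor : bracketing -> bracketing -> bracketing.

Fixpoint b_ob (a : bracketing) : C :=
  match a with
  | b_unit => munit
  | b_leaf A => A
  | b_tensor a b => b_ob a ⊗ b_ob b
  end.

(** Bracketings that differ only by associativity and units act by convertible objects; this lets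
    the constraints become identities below. *)
Fixpoint act (a : bracketing) (X : C) : C :=
  match a with
  | b_unit => X
  | b_leaf A => A ⊗ X
  | b_tensor a b => act a (act b X)
  end.

Fixpoint act_hom (a : bracketing) (X Y : C) (k : hom X Y) :
  hom (act a X) (act a Y) :=
  match a with
  | b_unit => k
  | b_leaf A => A ◁ k
  | b_tensor a b => act_hom a (act_hom b k)
  end.

Lemma act_id (a : bracketing) (X : C) : act_hom a (id X) = id (act a X).
Proof.
  revert X; induction a as [|A|a IHa b IHb]; intros X; cbn.
  - reflexivity.
  - apply tensor_id.
  - now rewrite IHb, IHa.
Qed.

Lemma act_comp (a : bracketing) (X Y Z : C) (g : hom Y Z) (f : hom X Y) :
  act_hom a (g ∘ f) = act_hom a g ∘ act_hom a f.
Proof.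
  revert X Y Z g f; induction a as [|A|a IHa b IHb]; intros; cbn.
  - reflexivity.
  - apply whisker_comp.
  - now rewrite IHb, IHa.
Qed.

Lemma act_iso_K (a : bracketing) (X Y : C) (i : iso X Y) :
  act_hom a (i⁻¹) ∘ act_hom a i = id (act a X).
Proof. now rewrite <- act_comp, iso_homK, act_id. Qed.

Lemma act_iso_VK (a : bracketing) (X Y : C) (i : iso X Y) :
  act_hom a i ∘ act_hom a (i⁻¹) = id (act a Y).
Proof. now rewrite <- act_comp, iso_invK, act_id. Qed.

Definition act_iso (a : bracketing) (X Y : C) (i : iso X Y) :
  iso (act a X) (act a Y) := Iso (act_iso_K a i) (act_iso_VK a i).

(** Built from constraints only: moves all brackets to the right and removes the units. *)
Fixpoint flat (a : bracketing) (X : C) : iso (b_ob a ⊗ X) (act a X) :=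
  match a with
  | b_unit => lunit
  | b_leaf A => iso_id (A ⊗ X)
  | b_tensor a b =>
      iso_comp (act_iso a (flat b X)) (iso_comp (flat a (b_ob b ⊗ X)) assoc)
  end.

Lemma flat_nat (a : bracketing) (X Y : C) (k : hom X Y) :
  flat a Y ∘ (b_ob a ◁ k) = act_hom a k ∘ flat a X.
Proof.
  revert X Y k; induction a as [|A|a IHa b IHb]; intros; cbn.
  - apply lunit_nat.
  - now rewrite comp_id_l, comp_id_r.
  - rewrite <- tensor_id, <- !comp_assoc, assoc_nat.
    rewrite (comp_assoc (flat a (b_ob b ⊗ Y))), IHa.
    now rewrite !comp_assoc, <- !act_comp, IHb.
Qed.

(* The arrow [f] acting on a bracket-free tail: under [A ↦ A ⊗ -] tensor
   products become composites of functors, so the constraints disappear. *)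
Definition st (a b : bracketing) (f : hom (b_ob a) (b_ob b)) (X : C) :
  hom (act a X) (act b X) := flat b X ∘ (f ▷ X) ∘ (flat a X)⁻¹.

(** Faithfulness of strictification: at the tail [munit], [st f] is [f ▷ munit] up to isomorphisms,
    and tensoring with the unit is faithful. *)
Lemma st_inj (a b : bracketing) (f g : hom (b_ob a) (b_ob b)) :
  (forall X, st f X = st g X) -> f = g.
Proof.
  intros E; apply whisker_unit_inj_r.
  apply (iso_cancel_l (i := flat b munit)).
  apply (iso_cancel_r (i := iso_sym (flat a munit))).
  apply E.
Qed.

Lemma st_id (a : bracketing) (X : C) : st (id (b_ob a)) X = id (act a X).
Proof. unfold st; rewrite tensor_id, comp_id_r; apply iso_invK. Qed.

Lemma st_comp (a b d : bracketing) (g : hom (b_ob b) (b_ob d))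
  (f : hom (b_ob a) (b_ob b)) (X : C) :
  @st a d (g ∘ f) X = st g X ∘ st f X.
Proof. unfold st; now rewrite comp_whisker, !comp_assoc, comp_isoK. Qed.

(** The interchange law for [f] and an arrow [k] of the tail, transported along [flat]. *)
Lemma st_nat (a b : bracketing) (f : hom (b_ob a) (b_ob b)) (X Y : C)
  (k : hom X Y) : act_hom b k ∘ st f X = st f Y ∘ act_hom a k.
Proof.
  unfold st.
  apply (iso_cancel_r (i := flat a X)).
  rewrite !comp_assoc, comp_isoK, <- (comp_assoc _ (act_hom a k)), <- flat_nat.
  rewrite <- flat_nat, comp_assoc, comp_isoK.
  now rewrite <- !comp_assoc, <- tensor_split, <- tensor_split'.
Qed.

Lemma st_tensor (a a' b b' : bracketing) (f : hom (b_ob a) (b_ob a'))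
  (g : hom (b_ob b) (b_ob b')) (X : C) :
  @st (b_tensor a b) (b_tensor a' b') (f ⊗₁ g) X
  = act_hom a' (st g X) ∘ st f (act b X).
Proof.
  (* Detaches the inverse flattening inside [st g X], so that [st_nat] can move it past [st f]. *)
  transitivity (act_hom a' (flat b' X ∘ (g ▷ X))
    ∘ (act_hom a' ((flat b X)⁻¹) ∘ st f (act b X))).
  2: { rewrite comp_assoc, <- act_comp; reflexivity. }
  rewrite st_nat; unfold st; cbn.
  rewrite act_comp, !comp_assoc.
  rewrite <- (comp_assoc _ (act_hom a' (g ▷ X))), <- (flat_nat a' (g ▷ X)).
  rewrite !comp_assoc.
  rewrite <- !(comp_assoc _ (b_ob a' ◁ (g ▷ X))), <- tensor_split.
  rewrite <- !(comp_assoc (act_hom a' (flat b' X))).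
  rewrite <- !(comp_assoc (flat a' (b_ob b' ⊗ X))).
  rewrite assoc_nat, comp_assoc.
  rewrite !comp_assoc, comp_isoVK; reflexivity.
Qed.

Lemma st_isoK (a b : bracketing) (i : iso (b_ob a) (b_ob b)) (X : C) :
  @st b a (i⁻¹) X ∘ @st a b i X = id (act a X).
Proof. now rewrite <- st_comp, iso_homK, st_id. Qed.

(** After cancelling the flattenings, this is the pentagon. *)
Lemma st_assoc (a b d : bracketing) (X : C) :
  @st (b_tensor (b_tensor a b) d) (b_tensor a (b_tensor b d)) assoc X
  = id (act a (act b (act d X))).
Proof.
  apply (iso_cancel_r (i := flat (b_tensor (b_tensor a b) d) X)).
  unfold st; rewrite comp_isoK, comp_id_l; cbn.
  rewrite !act_comp, !comp_assoc.
  rewrite <- (comp_assoc _ (act_hom a assoc)), <- flat_nat, !comp_assoc.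
  now rewrite pentagon_comp.
Qed.

Lemma st_assocV (a b d : bracketing) (X : C) :
  @st (b_tensor a (b_tensor b d)) (b_tensor (b_tensor a b) d) (assoc⁻¹) X
  = id (act a (act b (act d X))).
Proof.
  refine (eq_trans _ (st_isoK (a := b_tensor (b_tensor a b) d)
    (b := b_tensor a (b_tensor b d)) assoc X)).
  rewrite st_assoc; symmetry; apply comp_id_r.
Qed.

(** Rests on the left unit triangle [lunit_tensor], as [st_runit] rests on the middle triangle. *)
Lemma st_lunit (a : bracketing) (X : C) :
  @st (b_tensor b_unit a) a lunit X = id (act a X).
Proof.
  unfold st; cbn; rewrite <- lunit_tensor, !comp_assoc, !comp_isoVK.
  apply iso_invK.
Qed.

Lemma st_runit (a : bracketing) (X : C) :
  @st (b_tensor a b_unit) a runit X = id (act a X).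
Proof.
  unfold st; cbn; rewrite <- triangle, !comp_assoc, flat_nat.
  rewrite !comp_isoVK; apply act_iso_VK.
Qed.

Lemma st_lunitV (a : bracketing) (X : C) :
  @st a (b_tensor b_unit a) (lunit⁻¹) X = id (act a X).
Proof.
  refine (eq_trans _ (st_isoK (a := b_tensor b_unit a) (b := a) lunit X)).
  rewrite st_lunit; symmetry; apply comp_id_r.
Qed.

Lemma st_runitV (a : bracketing) (X : C) :
  @st a (b_tensor a b_unit) (runit⁻¹) X = id (act a X).
Proof.
  refine (eq_trans _ (st_isoK (a := b_tensor a b_unit) (b := a) runit X)).
  rewrite st_runit; symmetry; apply comp_id_r.
Qed.

Lemma comp_st_eq (a b : bracketing) (f g : hom (b_ob a) (b_ob b)) (E : f = g)
  (X Z : C) (k : hom (act b X) Z) : k ∘ st f X = k ∘ st g X.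
Proof. now rewrite E. Qed.

Lemma comp_st_nat (a b : bracketing) (f : hom (b_ob a) (b_ob b)) (X Y Z : C)
  (k : hom X Y) (h : hom (act b Y) Z) :
  h ∘ act_hom b k ∘ st f X = h ∘ st f Y ∘ act_hom a k.
Proof. now rewrite <- !comp_assoc, st_nat. Qed.

End Coherence.

Arguments b_unit {C}.

(** * Tactics that pass between arrows and their strict forms *)

Ltac bracketing_of A :=
  lazymatch A with
  | tensor ?X ?Y =>
      let x := bracketing_of X in
      let y := bracketing_of Y in constr:(b_tensor x y)
  | @munit ?C => constr:(@b_unit C)
  | _ => constr:(b_leaf A)
  end.

(** The [st] lemmas speak of [b_ob] of a bracketing and goals of plain objects; computing [b_ob]
    first makes the two agree syntactically. *)
Ltac rewrite_b_ob E :=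
  let H := fresh in pose proof E as H; cbn [b_ob] in H; rewrite H; clear H.

(** Normal form: a left-nested composite of whiskered strict generators without constraints. The
    middle object of a composite is reified because the two ends do not determine its bracketing. *)
Ltac push_st :=
  repeat match goal with
  | |- context [@st ?C ?a ?d (@comp _ _ ?B _ ?g ?f) ?X] =>
      let b := bracketing_of B in rewrite_b_ob (@st_comp C a b d g f X)
  | |- context [@st ?C (b_tensor ?a ?b) (b_tensor ?a' ?b')
                  (@tensor_hom _ _ _ _ _ ?f ?g) ?X] =>
      rewrite_b_ob (@st_tensor C a a' b b' f g X)
  | |- context [@st ?C ?a ?a (id _) ?X] => rewrite_b_ob (@st_id C a X)
  | |- context [@st ?C (b_tensor (b_tensor ?a ?b) ?d) _ (iso_hom assoc) ?X] =>
      rewrite_b_ob (@st_assoc C a b d X)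
  | |- context [@st ?C (b_tensor ?a (b_tensor ?b ?d)) _ (iso_inv assoc) ?X] =>
      rewrite_b_ob (@st_assocV C a b d X)
  | |- context [@st ?C (b_tensor b_unit ?a) _ (iso_hom lunit) ?X] =>
      rewrite_b_ob (@st_lunit C a X)
  | |- context [@st ?C ?a (b_tensor b_unit ?a) (iso_inv lunit) ?X] =>
      rewrite_b_ob (@st_lunitV C a X)
  | |- context [@st ?C (b_tensor ?a b_unit) _ (iso_hom runit) ?X] =>
      rewrite_b_ob (@st_runit C a X)
  | |- context [@st ?C ?a (b_tensor ?a b_unit) (iso_inv runit) ?X] =>
      rewrite_b_ob (@st_runitV C a X)
  end;
  repeat (rewrite act_id || rewrite act_comp);
  cbn [act act_hom];
  repeat (rewrite comp_id_l || rewrite comp_id_r || rewrite comp_assoc).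

Ltac strictify :=
  match goal with
  | |- @eq (hom ?A ?B) ?f ?g =>
      let a := bracketing_of A in
      let b := bracketing_of B in
      let X := fresh "X" in
      apply (@st_inj _ a b f g); intros X; push_st
  end.

(* Replaces the equation [E] by its strict form, composed with an arbitrary
   arrow on the left so that it rewrites inside left-nested composites. *)
Ltac strictify_hyp E :=
  match type of E with
  | @eq (@hom (mcat ?C) ?A ?B) ?f ?g =>
      let a := bracketing_of A in
      let b := bracketing_of B in
      let P := fresh "P" in
      let K := fresh "K" in
      (* The strict form is known only once [push_st] has run; unification then stores it in [P]. *)
      evar (P : forall X Z : C, hom (act b X) Z -> Prop);
      assert (K : forall (X Z : C) (k : hom (act b X) Z), P X Z k);
      [ let X := fresh "X" in
        let Z := fresh "Z" in
        let k := fresh "k" in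
        intros X Z k;
        generalize (@comp_st_eq C a b f g E X Z k); push_st;
        let H := fresh in intros H; subst P; exact H
      | subst P; cbv beta in K; cbn [act act_hom] in K;
        clear E; rename K into E ]
  end.

(** Interchange is the one law that strictification does not absorb, so it is applied by hand:
    [slide_down] moves [k] from after [f] to before it, [slide_up] the other way. *)
Ltac slide_eq a b f k H :=
  pose proof (fun Z => @comp_st_nat _ a b f _ _ Z k) as H;
  cbn [act act_hom] in H.

Tactic Notation "slide_down" constr(a) constr(b) constr(f) constr(k) :=
  let H := fresh in slide_eq a b f k H; rewrite H; clear H.

Tactic Notation "slide_up" constr(a) constr(b) constr(f) constr(k) :=
  let H := fresh in slide_eq a b f k H; rewrite <- H; clear H.

(** * Isomorphisms and crossings *)

Lemma is_iso_hom (C : category) (A B : C) (i : iso A B) : is_iso i.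
Proof. exists (i⁻¹); split; [apply iso_homK | apply iso_invK]. Qed.

Lemma is_iso_inv (C : category) (A B : C) (i : iso A B) : is_iso (i⁻¹).
Proof. exists i; split; [apply iso_invK | apply iso_homK]. Qed.

Lemma is_iso_id (C : category) (A : C) : is_iso (id A).
Proof. apply (is_iso_hom (iso_id A)). Qed.

Lemma is_iso_comp (C : category) (A B D : C) (g : hom B D) (f : hom A B) :
  is_iso g -> is_iso f -> is_iso (g ∘ f).
Proof.
  intros [g' [gK gVK]] [f' [fK fVK]].
  apply (is_iso_hom (iso_comp (Iso gK gVK) (Iso fK fVK))).
Qed.

Lemma is_iso_tensor (C : monoidal_category) (A A' B B' : C) (f : hom A A')
  (g : hom B B') : is_iso f -> is_iso g -> is_iso (f ⊗₁ g).
Proof.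
  intros [f' [fK fVK]] [g' [gK gVK]].
  apply (is_iso_hom (iso_tensor (Iso fK fVK) (Iso gK gVK))).
Qed.

Ltac solve_is_iso :=
  repeat first
    [ assumption | apply is_iso_comp | apply is_iso_tensor | apply is_iso_id
    | apply is_iso_hom | apply is_iso_inv ].

Lemma is_iso_middle (C : monoidal_category) (A B B' E E' D : C)
  (f : hom (B ⊗ E) (E' ⊗ B')) : is_iso f -> is_iso (middle A D f).
Proof. intros F; unfold middle; solve_is_iso. Qed.

Lemma middle_comp (C : monoidal_category)
  (A B B' B'' E E' E'' D : C) (g : hom (E' ⊗ B') (B'' ⊗ E''))
  (f : hom (B ⊗ E) (E' ⊗ B')) :
  middle A D g ∘ middle A D f = middle A D (g ∘ f).
Proof.
  unfold middle.
  rewrite !comp_assoc, comp_isoVK, <- (comp_assoc (assoc⁻¹)), <- whisker_comp.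
  now rewrite !comp_assoc, comp_isoK, comp_whisker, !comp_assoc.
Qed.

Lemma middle_invK (C : monoidal_category) (A B E D : C)
  (i : iso (B ⊗ E) (E ⊗ B)) :
  middle A D i ∘ middle A D (i⁻¹) = id _.
Proof.
  rewrite middle_comp, iso_invK; unfold middle.
  rewrite !tensor_id, comp_id_r, iso_invK, tensor_id, comp_id_r.
  apply iso_homK.
Qed.

Section Crossings.
Variable C : monoidal_category.

Local Notation st2 f X :=
  (@st C (b_tensor (b_leaf _) (b_leaf _)) (b_tensor (b_leaf _) (b_leaf _)) f X
    : hom (_ ⊗ _ ⊗ X) (_ ⊗ _ ⊗ X)).

(** The case of two letters of [comp_st_nat] with [act] computed, so that [rewrite] finds it in
    strictified goals. *)
Lemma comp_st_nat2 (A B A' B' X Y Z : C) (f : hom (A ⊗ B) (A' ⊗ B'))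
  (k : hom X Y) (h : hom (A' ⊗ B' ⊗ Y) Z) :
  h ∘ (A' ◁ B' ◁ k) ∘ st2 f X = h ∘ st2 f Y ∘ (A ◁ B ◁ k).
Proof.
  apply (@comp_st_nat C (b_tensor (b_leaf A) (b_leaf B))
    (b_tensor (b_leaf A') (b_leaf B'))).
Qed.

(** This and the next three are the crossings of units and of products, bracketed as in the
    compatibility conditions; those conditions thereby become naturality squares. *)
Definition cross_unit_l (W : C) : hom (munit ⊗ W) (W ⊗ munit) :=
  runit⁻¹ ∘ lunit.

Definition cross_unit_r (V : C) : hom (V ⊗ munit) (munit ⊗ V) :=
  lunit⁻¹ ∘ runit.

Definition cross_tensor_l (V V' W : C) (c : hom (V ⊗ W) (W ⊗ V))
  (d : hom (V' ⊗ W) (W ⊗ V')) : hom ((V ⊗ V') ⊗ W) (W ⊗ (V ⊗ V')) :=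
  assoc ∘ (c ▷ V') ∘ assoc⁻¹ ∘ (V ◁ d) ∘ assoc.

Definition cross_tensor_r (V W W' : C) (c : hom (V ⊗ W) (W ⊗ V))
  (d : hom (V ⊗ W') (W' ⊗ V)) : hom (V ⊗ (W ⊗ W')) ((W ⊗ W') ⊗ V) :=
  assoc⁻¹ ∘ (W ◁ d) ∘ assoc ∘ (c ▷ W') ∘ assoc⁻¹.

(** Both sides make the same four crossings and differ only in the order of [c] and [d'], which act
    on disjoint factors. *)
Lemma cross_tensor_interchange (V V' W W' : C) (c : hom (V ⊗ W) (W ⊗ V))
  (d : hom (V' ⊗ W) (W ⊗ V')) (c' : hom (V ⊗ W') (W' ⊗ V))
  (d' : hom (V' ⊗ W') (W' ⊗ V')) :
  cross_tensor_r (cross_tensor_l c d) (cross_tensor_l c' d')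
  = cross_tensor_l (cross_tensor_r c c') (cross_tensor_r d d').
Proof.
  unfold cross_tensor_l, cross_tensor_r; strictify.
  now rewrite comp_st_nat2.
Qed.

Lemma cross_tensor_r_unit (W W' : C) :
  cross_tensor_r (cross_unit_l W) (cross_unit_l W') = cross_unit_l (W ⊗ W').
Proof. unfold cross_tensor_r, cross_unit_l; now strictify. Qed.

Lemma cross_tensor_l_unit (V V' : C) :
  cross_tensor_l (cross_unit_r V) (cross_unit_r V') = cross_unit_r (V ⊗ V').
Proof. unfold cross_tensor_l, cross_unit_r; now strictify. Qed.

Lemma cross_unit_lr : cross_unit_l (@munit C) = cross_unit_r munit.
Proof. unfold cross_unit_l, cross_unit_r; now strictify. Qed.

(** On both sides [B] crosses [A'] and [A''], and [B'] crosses [A'']; only the order of the disjoint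
    crossings [c] and [e] differs. This is the associator case of [term_regroup]. *)
Lemma middle_assoc (A B A' B' A'' B'' : C) (c : hom (B ⊗ A') (A' ⊗ B))
  (d : hom (B ⊗ A'') (A'' ⊗ B)) (e : hom (B' ⊗ A'') (A'' ⊗ B')) :
  middle A (B' ⊗ B'') (cross_tensor_r c d) ∘ ((A ⊗ B) ◁ middle A' B'' e)
    ∘ assoc
  = (assoc ⊗₁ assoc) ∘ middle (A ⊗ A') B'' (cross_tensor_l d e)
    ∘ (middle A B' c ▷ (A'' ⊗ B'')).
Proof.
  unfold middle, cross_tensor_l, cross_tensor_r; strictify.
  now rewrite <- !(whisker_comp A), comp_st_nat2.
Qed.

Lemma middle_lunit (A B : C) :
  (lunit ⊗₁ lunit) ∘ middle munit B (cross_unit_l A) ∘ (lunit⁻¹ ▷ (A ⊗ B))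
  = lunit.
Proof. unfold middle, cross_unit_l; now strictify. Qed.

Lemma middle_runit (A B : C) :
  (runit ⊗₁ runit) ∘ middle A munit (cross_unit_r B) ∘ ((A ⊗ B) ◁ lunit⁻¹)
  = runit.
Proof. unfold middle, cross_unit_r; now strictify. Qed.

(** Naturality proofs are assembled by pasting such squares in both directions instead of rewriting
    long composites. *)
Definition square (A B A' B' : C) (p : hom A B) (p' : hom A' B')
  (a : hom A A') (b : hom B B') : Prop := p' ∘ a = b ∘ p.

Lemma square_id (A A' : C) (a : hom A A') : square (id A) (id A') a a.
Proof. unfold square; now rewrite comp_id_l, comp_id_r. Qed.

Lemma square_refl (A B : C) (p : hom A B) : square p p (id A) (id B).
Proof. unfold square; now rewrite comp_id_l, comp_id_r. Qed.

Lemma square_comp (A B D A' B' D' : C) (p : hom A B) (q : hom B D)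
  (p' : hom A' B') (q' : hom B' D') a b d :
  square p p' a b -> square q q' b d -> square (q ∘ p) (q' ∘ p') a d.
Proof.
  unfold square; intros E F.
  now rewrite <- comp_assoc, E, !comp_assoc, F.
Qed.

Lemma square_vcomp (A B A' B' A'' B'' : C) (p : hom A B) (p' : hom A' B')
  (p'' : hom A'' B'') a b a' b' :
  square p p' a b -> square p' p'' a' b' -> square p p'' (a' ∘ a) (b' ∘ b).
Proof.
  unfold square; intros E F.
  now rewrite comp_assoc, F, <- !comp_assoc, E.
Qed.

Lemma square_tensor (A B A' B' D E D' E' : C) (p : hom A B) (p' : hom A' B')
  (q : hom D E) (q' : hom D' E') a b d e :
  square p p' a b -> square q q' d e ->
  square (p ⊗₁ q) (p' ⊗₁ q') (a ⊗₁ d) (b ⊗₁ e).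
Proof. unfold square; intros F G; now rewrite <- !tensor_comp, F, G. Qed.

Lemma square_iso (A B A' B' : C) (p : iso A B) (p' : iso A' B') a b :
  square p p' a b -> square (p⁻¹) (p'⁻¹) b a.
Proof.
  unfold square; intros E; apply (iso_cancel_l (i := p')).
  apply (iso_cancel_r (i := p)).
  now rewrite !comp_assoc, iso_invK, comp_id_l, E, comp_isoK.
Qed.

Lemma square_isoV (A B A' B' : C) (p : hom A B) (p' : hom A' B')
  (a : iso A A') (b : iso B B') : square p p' a b -> square p' p (a⁻¹) (b⁻¹).
Proof.
  intros E; red; symmetry; apply (@square_iso _ _ _ _ a b); red; now symmetry.
Qed.

Lemma square_assoc (A B D A' B' D' : C) (a : hom A A') (b : hom B B')
  (d : hom D D') : square assoc assoc ((a ⊗₁ b) ⊗₁ d) (a ⊗₁ b ⊗₁ d).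
Proof. apply assoc_nat. Qed.

Lemma square_lunit (A A' : C) (a : hom A A') :
  square lunit lunit (id munit ⊗₁ a) a.
Proof. apply lunit_nat. Qed.

Lemma square_runit (A A' : C) (a : hom A A') :
  square runit runit (a ⊗₁ id munit) a.
Proof. apply runit_nat. Qed.

Lemma square_middle (A B B' E E' D A1 B1 B1' E1 E1' D1 : C)
  (f : hom (B ⊗ E) (E' ⊗ B')) (f1 : hom (B1 ⊗ E1) (E1' ⊗ B1'))
  (a : hom A A1) (b : hom B B1) (b' : hom B' B1') (e : hom E E1)
  (e' : hom E' E1') (d : hom D D1) :
  square f f1 (b ⊗₁ e) (e' ⊗₁ b') ->
  square (middle A D f) (middle A1 D1 f1)
    ((a ⊗₁ b) ⊗₁ (e ⊗₁ d)) ((a ⊗₁ e') ⊗₁ (b' ⊗₁ d)).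
Proof.
  intros F; unfold middle.
  eapply square_comp; [apply square_assoc|].
  eapply square_comp; [|apply square_iso, square_assoc].
  apply square_tensor; [apply square_id|].
  eapply square_comp; [apply square_iso, square_assoc|].
  eapply square_comp; [|apply square_assoc].
  apply square_tensor; [exact F | apply square_id].
Qed.

(** Naturality of a crossing at one pair of arrows. Up to moving constraints across, the
    compatibility conditions and the two mixed braid equations are the instances where [f] or [k] is
    an identity. *)
Definition slides (V V' W W' : C) (f : hom V V') (k : hom W W')
  (c : hom (V ⊗ W) (W ⊗ V)) (c' : hom (V' ⊗ W') (W' ⊗ V')) : Prop :=
  square c c' (f ⊗₁ k) (k ⊗₁ f).

Lemma slides_id (V W : C) (c : hom (V ⊗ W) (W ⊗ V)) :
  slides (id V) (id W) c c.
Proof. unfold slides; rewrite !tensor_id; apply square_refl. Qed.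

Lemma slides_comp (V V' V'' W W' W'' : C) (f : hom V V') (f' : hom V' V'')
  (k : hom W W') (k' : hom W' W'') c c' c'' :
  slides f k c c' -> slides f' k' c' c'' -> slides (f' ∘ f) (k' ∘ k) c c''.
Proof. unfold slides; rewrite !tensor_comp; apply square_vcomp. Qed.

Lemma slides_isoV (V V' W W' : C) (f : iso V V') (k : iso W W')
  (c : hom (V ⊗ W) (W ⊗ V)) (c' : hom (V' ⊗ W') (W' ⊗ V')) :
  slides f k c c' -> slides (f⁻¹) (k⁻¹) c' c.
Proof. apply (@square_isoV _ _ _ _ c c' (iso_tensor f k) (iso_tensor k f)). Qed.

Lemma slides_cross_tensor_l (V V' W V1 V1' W1 : C) (f : hom V V1)
  (f' : hom V' V1') (k : hom W W1) c d c1 d1 :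
  slides f k c c1 -> slides f' k d d1 ->
  slides (f ⊗₁ f') k (cross_tensor_l c d) (cross_tensor_l c1 d1).
Proof.
  intros F F'; unfold slides, cross_tensor_l.
  eapply square_comp; [apply square_assoc|].
  eapply square_comp; [apply square_tensor; [apply square_id | exact F']|].
  eapply square_comp; [apply square_iso, square_assoc|].
  eapply square_comp; [apply square_tensor; [exact F | apply square_id]|].
  apply square_assoc.
Qed.

Lemma slides_cross_tensor_r (V W W' V1 W1 W1' : C) (f : hom V V1)
  (k : hom W W1) (k' : hom W' W1') c d c1 d1 :
  slides f k c c1 -> slides f k' d d1 ->
  slides f (k ⊗₁ k') (cross_tensor_r c d) (cross_tensor_r c1 d1).
Proof.
  intros F F'; unfold slides, cross_tensor_r.
  eapply square_comp; [apply square_iso, square_assoc|].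
  eapply square_comp; [apply square_tensor; [exact F | apply square_id]|].
  eapply square_comp; [apply square_assoc|].
  eapply square_comp; [apply square_tensor; [apply square_id | exact F']|].
  apply square_iso, square_assoc.
Qed.

Lemma slides_cross_unit_l (W W' : C) (k : hom W W') :
  slides (id munit) k (cross_unit_l W) (cross_unit_l W').
Proof.
  eapply square_comp; [apply square_lunit | apply square_iso, square_runit].
Qed.

Lemma slides_cross_unit_r (V V' : C) (f : hom V V') :
  slides f (id munit) (cross_unit_r V) (cross_unit_r V').
Proof.
  eapply square_comp; [apply square_runit | apply square_iso, square_lunit].
Qed.

Lemma slides_assoc_l (V V' V'' W : C) (c : hom (V ⊗ W) (W ⊗ V))
  (d : hom (V' ⊗ W) (W ⊗ V')) (e : hom (V'' ⊗ W) (W ⊗ V'')) :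
  slides assoc (id W) (cross_tensor_l (cross_tensor_l c d) e)
    (cross_tensor_l c (cross_tensor_l d e)).
Proof. unfold slides, square, cross_tensor_l; now strictify. Qed.

Lemma slides_assoc_r (V W W' W'' : C) (c : hom (V ⊗ W) (W ⊗ V))
  (d : hom (V ⊗ W') (W' ⊗ V)) (e : hom (V ⊗ W'') (W'' ⊗ V)) :
  slides (id V) assoc (cross_tensor_r (cross_tensor_r c d) e)
    (cross_tensor_r c (cross_tensor_r d e)).
Proof. unfold slides, square, cross_tensor_r; now strictify. Qed.

Lemma slides_lunit_l (V W : C) (c : hom (V ⊗ W) (W ⊗ V)) :
  slides lunit (id W) (cross_tensor_l (cross_unit_l W) c) c.
Proof. unfold slides, square, cross_tensor_l, cross_unit_l; now strictify. Qed.

Lemma slides_runit_l (V W : C) (c : hom (V ⊗ W) (W ⊗ V)) :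
  slides runit (id W) (cross_tensor_l c (cross_unit_l W)) c.
Proof. unfold slides, square, cross_tensor_l, cross_unit_l; now strictify. Qed.

Lemma slides_lunit_r (V W : C) (c : hom (V ⊗ W) (W ⊗ V)) :
  slides (id V) lunit (cross_tensor_r (cross_unit_r V) c) c.
Proof. unfold slides, square, cross_tensor_r, cross_unit_r; now strictify. Qed.

Lemma slides_runit_r (V W : C) (c : hom (V ⊗ W) (W ⊗ V)) :
  slides (id V) runit (cross_tensor_r c (cross_unit_r V)) c.
Proof. unfold slides, square, cross_tensor_r, cross_unit_r; now strictify. Qed.

End Crossings.

(** * Words, terms and transfer *)

Inductive word : Type :=
| w_unit : word
| w_letter : word
| w_tensor : word -> word -> word.

Fixpoint power (C : monoidal_category) (A : C) (w : word) : C :=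
  match w with
  | w_unit => munit
  | w_letter => A
  | w_tensor u v => power A u ⊗ power A v
  end.

Section Terms.
Variable gen : word -> word -> Type.

(** The constraints are constructors, so each equational axiom is, up to conversion, an equation
    between evaluations of two terms. *)
Inductive term : word -> word -> Type :=
| t_gen : forall w v, gen w v -> term w v
| t_id : forall w, term w w
| t_comp : forall u v w, term v w -> term u v -> term u w
| t_tensor : forall u u' v v',
    term u u' -> term v v' -> term (w_tensor u v) (w_tensor u' v')
| t_assoc : forall u v w,
    term (w_tensor (w_tensor u v) w) (w_tensor u (w_tensor v w))
| t_assocV : forall u v w,
    term (w_tensor u (w_tensor v w)) (w_tensor (w_tensor u v) w)
| t_lunit : forall w, term (w_tensor w_unit w) w
| t_lunitV : forall w, term w (w_tensor w_unit w)
| t_runit : forall w, term (w_tensor w w_unit) w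
| t_runitV : forall w, term w (w_tensor w w_unit).

Definition interpretation (C : monoidal_category) (A : C) : Type :=
  forall w v, gen w v -> hom (power A w) (power A v).

Fixpoint eval (C : monoidal_category) (A : C) (I : interpretation A)
  (w v : word) (t : term w v) : hom (power A w) (power A v) :=
  match t with
  | t_gen g => I _ _ g
  | t_id w => id (power A w)
  | t_comp g f => eval I g ∘ eval I f
  | t_tensor f g => eval I f ⊗₁ eval I g
  | t_assoc u v w => assoc
  | t_assocV u v w => assoc⁻¹
  | t_lunit w => lunit
  | t_lunitV w => lunit⁻¹
  | t_runit w => runit
  | t_runitV w => runit⁻¹
  end.

Section Transfer.
Variables (C : monoidal_category) (H L : C) (c : iso (L ⊗ H) (H ⊗ L)).

Fixpoint cross_l (w : word) : hom (power L w ⊗ H) (H ⊗ power L w) :=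
  match w with
  | w_unit => cross_unit_l H
  | w_letter => c
  | w_tensor u v => cross_tensor_l (cross_l u) (cross_l v)
  end.

Fixpoint cross_r (w : word) : hom (L ⊗ power H w) (power H w ⊗ L) :=
  match w with
  | w_unit => cross_unit_r L
  | w_letter => c
  | w_tensor u v => cross_tensor_r (cross_r u) (cross_r v)
  end.

(** The recursion favours the second word; the next three lemmas recover the recursion on the
    first. *)
Fixpoint cross (w v : word) :
  hom (power L w ⊗ power H v) (power H v ⊗ power L w) :=
  match v with
  | w_unit => cross_unit_r (power L w)
  | w_letter => cross_l w
  | w_tensor v v' => cross_tensor_r (cross w v) (cross w v')
  end.

Lemma cross_letter_l (v : word) : cross w_letter v = cross_r v.
Proof.
  induction v as [| |v IHv v' IHv']; cbn; [easy..|].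
  now rewrite IHv, IHv'.
Qed.

Lemma cross_w_unit_l (v : word) : cross w_unit v = cross_unit_l (power H v).
Proof.
  induction v as [| |v IHv v' IHv']; cbn; [now rewrite cross_unit_lr|easy|].
  rewrite IHv, IHv'; apply cross_tensor_r_unit.
Qed.

Lemma cross_w_tensor_l (w w' v : word) :
  cross (w_tensor w w') v = cross_tensor_l (cross w v) (cross w' v).
Proof.
  induction v as [| |v IHv v' IHv']; cbn; [|easy|].
  - now rewrite cross_tensor_l_unit.
  - rewrite IHv, IHv'; apply cross_tensor_interchange.
Qed.

Fixpoint regroup (w : word) : hom (power (H ⊗ L) w) (power H w ⊗ power L w) :=
  match w with
  | w_unit => lunit⁻¹
  | w_letter => id (H ⊗ L)
  | w_tensor u v =>
      middle (power H u) (power L v) (cross u v) ∘ (regroup u ⊗₁ regroup v)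
  end.

Variables (IH : interpretation H) (IL : interpretation L).
Variable (IT : interpretation (H ⊗ L)).

Hypothesis gen_slides_l : forall w v (g : gen w v),
  slides (IL g) (id H) (cross_l w) (cross_l v).
Hypothesis gen_slides_r : forall w v (g : gen w v),
  slides (id L) (IH g) (cross_r w) (cross_r v).
Hypothesis gen_regroup : forall w v (g : gen w v),
  square (regroup w) (regroup v) (IT g) (IH g ⊗₁ IL g).

Lemma term_slides_l (w v : word) (t : term w v) :
  slides (eval IL t) (id H) (cross_l w) (cross_l v).
Proof.
  induction t; cbn.
  - apply gen_slides_l.
  - apply slides_id.
  - rewrite <- (comp_id_l (id H)); eapply slides_comp; eassumption.
  - now apply slides_cross_tensor_l.
  - apply slides_assoc_l.
  - apply (@slides_isoV _ _ _ _ _ assoc (iso_id H)), slides_assoc_l.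
  - apply slides_lunit_l.
  - apply (@slides_isoV _ _ _ _ _ lunit (iso_id H)), slides_lunit_l.
  - apply slides_runit_l.
  - apply (@slides_isoV _ _ _ _ _ runit (iso_id H)), slides_runit_l.
Qed.

Lemma term_slides_r (w v : word) (t : term w v) :
  slides (id L) (eval IH t) (cross_r w) (cross_r v).
Proof.
  induction t; cbn.
  - apply gen_slides_r.
  - apply slides_id.
  - rewrite <- (comp_id_l (id L)); eapply slides_comp; eassumption.
  - now apply slides_cross_tensor_r.
  - apply slides_assoc_r.
  - apply (@slides_isoV _ _ _ _ _ (iso_id L) assoc), slides_assoc_r.
  - apply slides_lunit_r.
  - apply (@slides_isoV _ _ _ _ _ (iso_id L) lunit), slides_lunit_r.
  - apply slides_runit_r.
  - apply (@slides_isoV _ _ _ _ _ (iso_id L) runit), slides_runit_r.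
Qed.

(** First [t'] slides past a fixed power of [L], then [t] past a fixed power of [H], each by
    induction on the fixed word down to a single letter. *)
Lemma term_slides (w v w' v' : word) (t : term w v) (t' : term w' v') :
  slides (eval IL t) (eval IH t') (cross w w') (cross v v').
Proof.
  rewrite <- (comp_id_r (eval IL t)), <- (comp_id_l (eval IH t')).
  apply slides_comp with (cross w v').
  - clear t; induction w as [| |w IHw u IHu].
    + rewrite !cross_w_unit_l; apply slides_cross_unit_l.
    + rewrite !cross_letter_l; apply term_slides_r.
    + rewrite !cross_w_tensor_l; cbn; rewrite <- tensor_id.
      now apply slides_cross_tensor_l.
  - clear t'; induction v' as [| |u IHu u' IHu']; cbn.
    + apply slides_cross_unit_r.
    + apply term_slides_l.
    + rewrite <- tensor_id; now apply slides_cross_tensor_r.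
Qed.

(** A tensor product of terms passes the crossing inside [regroup] by [term_slides]; the constraints
    pass by coherence of [middle]. *)
Lemma term_regroup (w v : word) (t : term w v) :
  square (regroup w) (regroup v) (eval IT t) (eval IH t ⊗₁ eval IL t).
Proof.
  (* The three constraints are treated apart from the induction because their inverses reuse the
     same squares. *)
  assert (Assoc : forall u v w : word,
    square (regroup (w_tensor (w_tensor u v) w))
      (regroup (w_tensor u (w_tensor v w))) assoc (assoc ⊗₁ assoc)).
  { clear; intros u v w; unfold square; cbn; rewrite cross_w_tensor_l.
    rewrite tensor_comp_r, tensor_comp_l, <- !comp_assoc, <- assoc_nat.
    rewrite !comp_assoc; f_equal; apply middle_assoc. }
  assert (Lunit : forall w : word,
    square (regroup (w_tensor w_unit w)) (regroup w) lunit (lunit ⊗₁ lunit)).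
  { clear; intros w; unfold square; cbn; rewrite cross_w_unit_l.
    now rewrite (tensor_split' (lunit⁻¹)), !comp_assoc, middle_lunit, lunit_nat. }
  assert (Runit : forall w : word,
    square (regroup (w_tensor w w_unit)) (regroup w) runit (runit ⊗₁ runit)).
  { clear; intros w; unfold square; cbn.
    now rewrite (tensor_split _ (lunit⁻¹)), !comp_assoc, middle_runit, runit_nat. }
  induction t; cbn.
  - apply gen_regroup.
  - rewrite tensor_id; apply square_refl.
  - rewrite tensor_comp; eapply square_vcomp; eassumption.
  - eapply square_comp; [apply square_tensor; eassumption|].
    apply square_middle, term_slides.
  - apply Assoc.
  - apply (@square_isoV _ _ _ _ _ _ _ assoc (iso_tensor assoc assoc)), Assoc.
  - apply Lunit.
  - apply (@square_isoV _ _ _ _ _ _ _ lunit (iso_tensor lunit lunit)), Lunit.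
  - apply Runit.
  - apply (@square_isoV _ _ _ _ _ _ _ runit (iso_tensor runit runit)), Runit.
Qed.

Lemma is_iso_regroup (w : word) : is_iso (regroup w).
Proof.
  assert (Cross_l : forall v, is_iso (cross_l v)).
  { clear; induction v as [| |v IHv v' IHv']; cbn.
    - apply is_iso_comp; [apply is_iso_inv | apply is_iso_hom].
    - apply is_iso_hom.
    - unfold cross_tensor_l; solve_is_iso. }
  assert (Cross : forall v v', is_iso (cross v v')).
  { clear - Cross_l; induction v' as [| |v' IHv v'' IHv']; cbn.
    - unfold cross_unit_r; solve_is_iso.
    - apply Cross_l.
    - unfold cross_tensor_r; solve_is_iso. }
  induction w as [| |w IHw v IHv]; cbn.
  - apply is_iso_inv.
  - apply is_iso_id.
  - apply is_iso_comp; [apply is_iso_middle, Cross|].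
    now apply is_iso_tensor.
Qed.

(** By [term_regroup], an evaluation in [H ⊗ L] followed by [regroup v] depends only on the
    evaluations in [H] and in [L]; [regroup v] is then cancelled. *)
Lemma eval_transfer (w v : word) (s t : term w v) :
  eval IH s = eval IH t -> eval IL s = eval IL t -> eval IT s = eval IT t.
Proof.
  intros EH EL; destruct (is_iso_regroup v) as [g [gK _]].
  rewrite <- (comp_id_l (eval IT s)), <- (comp_id_l (eval IT t)), <- gK.
  rewrite <- !comp_assoc; f_equal.
  rewrite (term_regroup s), (term_regroup t), EH, EL; reflexivity.
Qed.

End Transfer.
End Terms.

(** * Antipodes *)

Section Antipode.
Variables (C : monoidal_category) (V W : C) (mu : hom (V ⊗ V) V)
  (eta : hom munit V) (Delta : hom V (V ⊗ V)) (eps : hom V munit).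

Local Notation v := (b_leaf V).
Local Notation w := (b_leaf W).
Local Notation m := (@st C (b_tensor v v) v mu).
Local Notation e := (@st C b_unit v eta).
Local Notation d := (@st C v (b_tensor v v) Delta).
Local Notation s S := (@st C v v S).
Local Notation r R := (@st C (b_tensor v w) (b_tensor v w) R).

(** Uniqueness of inverses for convolution with a spectator [W]: [S] is a left and [R] a right
    inverse of the identity, and the product of [S], the identity and [R] is evaluated in two
    ways. *)
Lemma antipode_unique (S : hom V V) (R : hom (V ⊗ W) (V ⊗ W)) :
  is_algebra mu eta -> is_coalgebra Delta eps ->
  convolution mu Delta S (id V) = eta ∘ eps ->
  (mu ▷ W) ∘ assoc⁻¹ ∘ (V ◁ R) ∘ assoc ∘ (Delta ▷ W) = (eta ∘ eps) ▷ W ->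
  R = S ▷ W.
Proof.
  intros [muA [etaL etaR]] [DeltaA [epsL epsR]] SL E.
  unfold convolution in SL.
  (* In the triple product the factor containing [R] stands to the right of the strand that carries
     [S]. *)
  pose proof (f_equal (fun g => V ◁ g) E) as EV; cbv beta in EV.
  strictify_hyp muA; strictify_hyp etaL; strictify_hyp etaR.
  strictify_hyp DeltaA; strictify_hyp epsL; strictify_hyp epsR.
  strictify_hyp SL; strictify_hyp EV; clear E.
  strictify.
  (* The triple product. The leading identity is there because strictified equations rewrite only
     below another arrow. *)
  transitivity (id (V ⊗ W ⊗ X) ∘ m (W ⊗ X) ∘ s S (V ⊗ W ⊗ X) ∘ (V ◁ m (W ⊗ X))
    ∘ (V ◁ V ◁ r R X) ∘ (V ◁ d (W ⊗ X)) ∘ d (W ⊗ X));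
    cbn [act act_hom]; [symmetry|].
  - slide_up v v S (m (W ⊗ X)).
    rewrite <- muA, <- DeltaA.
    slide_down v (b_tensor v v) Delta (r R X).
    rewrite SL, etaL.
    slide_up v (@b_unit C) eps (r R X).
    now rewrite epsL, comp_id_l.
  - rewrite EV, epsR.
    slide_up v v S (e (W ⊗ X)).
    now rewrite etaR, comp_id_l.
Qed.

(** Compatibility makes the conjugate [c⁻¹ ∘ (W ◁ S) ∘ c] a right convolution inverse of the
    identity with spectator [W], so it equals [S ▷ W]. *)
Lemma antipode_slides_l (S : hom V V) (c : iso (V ⊗ W) (W ⊗ V)) :
  is_algebra mu eta -> is_coalgebra Delta eps ->
  compat_algebra_l mu eta c -> compat_coalgebra_l Delta eps c ->
  is_antipode mu eta Delta eps S -> slides S (id W) c c.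
Proof.
  intros algV coalgV [c_eta c_mu] [c_eps c_Delta] [SL SR].
  unfold slides, square.
  rewrite <- (antipode_unique (R := c⁻¹ ∘ (W ◁ S) ∘ c) algV coalgV SL).
  - now rewrite !comp_assoc, iso_invK, comp_id_l.
  (* With [c] in front, [c_mu] splits it into two crossings, one of which cancels the [c⁻¹] of the
     conjugate. *)
  - apply (iso_cancel_l (i := c)).
    pose proof (iso_invK c) as cVK.
    pose proof (f_equal (fun g => V ◁ g) cVK) as VcVK; cbv beta in VcVK.
    clear cVK.
    pose proof (f_equal (fun g => W ◁ g) SR) as WSR.
    unfold convolution in WSR; clear SL SR algV coalgV.
    strictify_hyp c_mu; strictify_hyp c_eta; strictify_hyp c_eps.
    strictify_hyp c_Delta; strictify_hyp VcVK; strictify_hyp WSR.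
    (* Puts an identity in front of both sides so that the strict equations also apply to the
       outermost arrows. *)
    strictify; apply (iso_cancel_l (i := iso_id (W ⊗ V ⊗ X))).
    cbn [iso_hom iso_id]; rewrite !comp_assoc.
    rewrite c_mu, VcVK.
    slide_up (b_tensor v w) (b_tensor w v) (iso_hom c) (s S X).
    now rewrite <- c_Delta, WSR, c_eps, c_eta.
Qed.

End Antipode.

(** * Left-right symmetry by reversing the tensor product *)

Section Reverse.
Variable C : monoidal_category.

Lemma pentagon_inv (A B D E : C) :
  (assoc⁻¹ ▷ E) ∘ assoc⁻¹ ∘ (A ◁ assoc⁻¹)
  = (@assoc C (A ⊗ B) D E)⁻¹ ∘ assoc⁻¹.
Proof. now strictify. Qed.

Lemma triangle_inv (A B : C) :
  (runit ▷ B) ∘ assoc⁻¹ = A ◁ lunit.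
Proof. now strictify. Qed.

Definition reverse : monoidal_category :=
  @MonoidalCategory C
    (fun A B => B ⊗ A)
    (fun A A' B B' f g => g ⊗₁ f)
    (fun A B => tensor_id B A)
    (fun A A' A'' B B' B'' f' f g' g => tensor_comp g' g f' f)
    munit
    (fun A B D => iso_sym (@assoc C D B A))
    (fun A => runit)
    (fun A => lunit)
    (fun A A' B B' D D' f g h => square_iso (square_assoc h g f))
    (fun A A' f => runit_nat f)
    (fun A A' f => lunit_nat f)
    (fun A B D E => pentagon_inv E D B A)
    (fun A B => triangle_inv B A).

(** This is [antipode_slides_l] read in [reverse C]: the compatibility conditions there are the
    given ones up to conversion, and only associativity and coassociativity have to be
    rebracketed. *)
Lemma antipode_slides_r (V W : C) (mu : hom (W ⊗ W) W) (eta : hom munit W)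
  (Delta : hom W (W ⊗ W)) (eps : hom W munit) (S : hom W W)
  (c : iso (V ⊗ W) (W ⊗ V)) :
  is_algebra mu eta -> is_coalgebra Delta eps ->
  compat_algebra_r mu eta c -> compat_coalgebra_r Delta eps c ->
  is_antipode mu eta Delta eps S -> slides (id V) S c c.
Proof.
  intros [muA [etaL etaR]] [DeltaA [epsL epsR]] c_alg c_coalg [SL SR].
  apply (@antipode_slides_l reverse W V mu eta Delta eps S c);
    [| |exact c_alg|exact c_coalg|now split].
  - split; [|now split].
    cbn; now rewrite muA, comp_isoVK.
  - split; [|now split].
    cbn; now rewrite <- comp_assoc, <- DeltaA, !comp_assoc, iso_homK, comp_id_l.
Qed.

End Reverse.

(** * Braided Hopf algebras *)

Inductive hopf_gen : word -> word -> Type :=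
| g_mul : hopf_gen (w_tensor w_letter w_letter) w_letter
| g_unit : hopf_gen w_unit w_letter
| g_comul : hopf_gen w_letter (w_tensor w_letter w_letter)
| g_counit : hopf_gen w_letter w_unit
| g_braid :
    hopf_gen (w_tensor w_letter w_letter) (w_tensor w_letter w_letter)
| g_antipode : hopf_gen w_letter w_letter.

Definition hopf_interp (C : monoidal_category) (A : C) (mu : hom (A ⊗ A) A)
  (eta : hom munit A) (Delta : hom A (A ⊗ A)) (eps : hom A munit)
  (c : hom (A ⊗ A) (A ⊗ A)) (S : hom A A) : interpretation hopf_gen A :=
  fun w v g =>
    match g with
    | g_mul => mu
    | g_unit => eta
    | g_comul => Delta
    | g_counit => eps
    | g_braid => c
    | g_antipode => S
    end.

Section Product.
Variables (C : monoidal_category) (H L : C)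
  (muH : hom (H ⊗ H) H) (etaH : hom munit H)
  (DeltaH : hom H (H ⊗ H)) (epsH : hom H munit) (cH : hom (H ⊗ H) (H ⊗ H))
  (muL : hom (L ⊗ L) L) (etaL : hom munit L)
  (DeltaL : hom L (L ⊗ L)) (epsL : hom L munit) (cL : hom (L ⊗ L) (L ⊗ L))
  (cLH : iso (L ⊗ H) (H ⊗ L)).
Hypothesis braid_LLH :
  (cLH ▷ L) ∘ assoc⁻¹ ∘ (L ◁ cLH) ∘ assoc ∘ (cL ▷ H)
  = assoc⁻¹ ∘ (H ◁ cL) ∘ assoc ∘ (cLH ▷ L) ∘ assoc⁻¹ ∘ (L ◁ cLH) ∘ assoc.
Hypothesis braid_LHH :
  (cH ▷ L) ∘ assoc⁻¹ ∘ (H ◁ cLH) ∘ assoc ∘ (cLH ▷ H)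
  = assoc⁻¹ ∘ (H ◁ cLH) ∘ assoc ∘ (cLH ▷ H) ∘ assoc⁻¹ ∘ (L ◁ cH) ∘ assoc.
Hypothesis compat_alg_L : compat_algebra_l muL etaL cLH.
Hypothesis compat_coalg_L : compat_coalgebra_l DeltaL epsL cLH.
Hypothesis compat_alg_H : compat_algebra_r muH etaH cLH.
Hypothesis compat_coalg_H : compat_coalgebra_r DeltaH epsH cLH.

(** The (co)algebra generators slide by compatibility with [L], the braid by [braid_LLH], the
    antipode by [slideS]. The mirror lemma uses [H] and [braid_LHH]. *)
Lemma hopf_gen_slides_l (SL : hom L L) (slideS : slides SL (id H) cLH cLH)
  (w v : word) (g : hopf_gen w v) :
  slides (hopf_interp muL etaL DeltaL epsL cL SL g) (id H)
    (cross_l cLH w) (cross_l cLH v).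
Proof.
  destruct compat_alg_L as [c_eta c_mu], compat_coalg_L as [c_eps c_Delta].
  destruct g; unfold slides, square; cbn; unfold cross_unit_l, cross_tensor_l.
  - now rewrite c_mu, !comp_assoc.
  - now rewrite c_eta, !comp_assoc.
  - now rewrite c_Delta.
  - apply (iso_cancel_l (i := runit)).
    now rewrite !comp_assoc, iso_invK, comp_id_l, c_eps.
  - apply (iso_cancel_l (i := iso_sym assoc)); cbn.
    rewrite !comp_assoc, iso_homK, comp_id_l; exact braid_LLH.
  - exact slideS.
Qed.

Lemma hopf_gen_slides_r (SH : hom H H) (slideS : slides (id L) SH cLH cLH)
  (w v : word) (g : hopf_gen w v) :
  slides (id L) (hopf_interp muH etaH DeltaH epsH cH SH g)
    (cross_r cLH w) (cross_r cLH v).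
Proof.
  destruct compat_alg_H as [c_eta c_mu], compat_coalg_H as [c_eps c_Delta].
  destruct g; unfold slides, square; cbn; unfold cross_unit_r, cross_tensor_r.
  - now rewrite c_mu, !comp_assoc.
  - now rewrite c_eta, !comp_assoc.
  - now rewrite c_Delta.
  - apply (iso_cancel_l (i := lunit)).
    now rewrite !comp_assoc, iso_invK, comp_id_l, c_eps.
  - apply (iso_cancel_r (i := assoc)).
    rewrite !comp_assoc, comp_isoK; exact (eq_sym braid_LHH).
  - exact slideS.
Qed.

Let mu : hom ((H ⊗ L) ⊗ (H ⊗ L)) (H ⊗ L) :=
  (muH ⊗₁ muL) ∘ middle H L cLH.
Let eta : hom munit (H ⊗ L) := (etaH ⊗₁ etaL) ∘ lunit⁻¹.
Let Delta : hom (H ⊗ L) ((H ⊗ L) ⊗ (H ⊗ L)) :=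
  middle H L (cLH⁻¹) ∘ (DeltaH ⊗₁ DeltaL).
Let eps : hom (H ⊗ L) munit := lunit ∘ (epsH ⊗₁ epsL).
Let c : hom ((H ⊗ L) ⊗ (H ⊗ L)) ((H ⊗ L) ⊗ (H ⊗ L)) :=
  middle H L (cLH⁻¹) ∘ (cH ⊗₁ cL) ∘ middle H L cLH.

(** The structure of [H ⊗ L] is the tensor product structure conjugated by [regroup], so [middle] of
    [cLH] meets its inverse or already matches. *)
Lemma hopf_gen_regroup (SH : hom H H) (SL : hom L L)
  (w v : word) (g : hopf_gen w v) :
  square (regroup cLH w) (regroup cLH v)
    (hopf_interp mu eta Delta eps c (SH ⊗₁ SL) g)
    (hopf_interp muH etaH DeltaH epsH cH SH g
      ⊗₁ hopf_interp muL etaL DeltaL epsL cL SL g).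
Proof.
  destruct g; unfold square; cbn; unfold mu, eta, Delta, eps, c;
    rewrite ?tensor_id, ?comp_id_l, ?comp_id_r; try reflexivity.
  - now rewrite comp_assoc, middle_invK, comp_id_l.
  - now rewrite comp_assoc, iso_homK, comp_id_l.
  - now rewrite !comp_assoc, middle_invK, comp_id_l.
Qed.

Lemma hopf_transfer (SH : hom H H) (SL : hom L L)
  (slideL : slides SL (id H) cLH cLH) (slideH : slides (id L) SH cLH cLH)
  (w v : word) (s t : term hopf_gen w v) :
  eval (hopf_interp muH etaH DeltaH epsH cH SH) s
  = eval (hopf_interp muH etaH DeltaH epsH cH SH) t ->
  eval (hopf_interp muL etaL DeltaL epsL cL SL) s
  = eval (hopf_interp muL etaL DeltaL epsL cL SL) t ->
  eval (hopf_interp mu eta Delta eps c (SH ⊗₁ SL)) s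
  = eval (hopf_interp mu eta Delta eps c (SH ⊗₁ SL)) t.
Proof.
  apply eval_transfer with cLH.
  - now apply hopf_gen_slides_l.
  - now apply hopf_gen_slides_r.
  - apply hopf_gen_regroup.
Qed.

End Product.

(** * Reading terms off the axioms *)

Ltac word_of A X :=
  lazymatch X with
  | A => constr:(w_letter)
  | munit => constr:(w_unit)
  | tensor ?Y ?Z =>
      let y := word_of A Y in
      let z := word_of A Z in constr:(w_tensor y z)
  end.

Ltac term_of A mu eta Delta eps c S f :=
  let rec go f :=
    lazymatch f with
    (* Must precede the case of [S], which may itself be an identity: read as the antipode
       generator, an identity would evaluate in [H ⊗ L] to a tensor product of two identities. *)
    | id ?X => let w := word_of A X in constr:(@t_id hopf_gen w)
    | mu => constr:(t_gen g_mul)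
    | eta => constr:(t_gen g_unit)
    | Delta => constr:(t_gen g_comul)
    | eps => constr:(t_gen g_counit)
    | c => constr:(t_gen g_braid)
    | S => constr:(t_gen g_antipode)
    | comp ?g ?h =>
        let s := go g in
        let t := go h in constr:(t_comp s t)
    | tensor_hom ?g ?h =>
        let s := go g in
        let t := go h in constr:(t_tensor s t)
    | iso_hom (@assoc _ ?X ?Y ?Z) =>
        let x := word_of A X in
        let y := word_of A Y in
        let z := word_of A Z in constr:(@t_assoc hopf_gen x y z)
    | iso_inv (@assoc _ ?X ?Y ?Z) =>
        let x := word_of A X in
        let y := word_of A Y in
        let z := word_of A Z in constr:(@t_assocV hopf_gen x y z)
    | iso_hom (@lunit _ ?X) =>
        let x := word_of A X in constr:(@t_lunit hopf_gen x)
    | iso_inv (@lunit _ ?X) =>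
        let x := word_of A X in constr:(@t_lunitV hopf_gen x)
    | iso_hom (@runit _ ?X) =>
        let x := word_of A X in constr:(@t_runit hopf_gen x)
    | iso_inv (@runit _ ?X) =>
        let x := word_of A X in constr:(@t_runitV hopf_gen x)
    end in
  go f.

(** The terms are read off the axiom [E] of [H]; the axiom [E'] of [L] and the goal are their other
    evaluations up to conversion. *)
Ltac by_transfer transfer E E' :=
  let T := type of E in
  let T := eval unfold braid_equation, convolution, unit_mul, unit_comul,
    middle in T in
  lazymatch T with
  | ?f = ?g =>
      lazymatch type of transfer with
      | context [@hopf_interp _ ?A ?mu ?eta ?Delta ?eps ?c ?S] =>
          let s := term_of A mu eta Delta eps c S f in
          let t := term_of A mu eta Delta eps c S g in
          exact (transfer _ _ s t E E')
      end
  end.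

Theorem proposition2p1 (C : monoidal_category) (H L : C)
  (muH : hom (H ⊗ H) H) (etaH : hom munit H)
  (DeltaH : hom H (H ⊗ H)) (epsH : hom H munit) (cH : hom (H ⊗ H) (H ⊗ H))
  (muL : hom (L ⊗ L) L) (etaL : hom munit L)
  (DeltaL : hom L (L ⊗ L)) (epsL : hom L munit) (cL : hom (L ⊗ L) (L ⊗ L))
  (cLH : iso (L ⊗ H) (H ⊗ L))
  (bialgH : is_braided_bialgebra muH etaH DeltaH epsH cH)
  (bialgL : is_braided_bialgebra muL etaL DeltaL epsL cL)
  (braid_LLH :
    (cLH ▷ L) ∘ assoc⁻¹ ∘ (L ◁ cLH) ∘ assoc ∘ (cL ▷ H)
    = assoc⁻¹ ∘ (H ◁ cL) ∘ assoc ∘ (cLH ▷ L) ∘ assoc⁻¹ ∘ (L ◁ cLH) ∘ assoc)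
  (braid_LHH :
    (cH ▷ L) ∘ assoc⁻¹ ∘ (H ◁ cLH) ∘ assoc ∘ (cLH ▷ H)
    = assoc⁻¹ ∘ (H ◁ cLH) ∘ assoc ∘ (cLH ▷ H) ∘ assoc⁻¹ ∘ (L ◁ cH) ∘ assoc)
  (compat_alg_L : compat_algebra_l muL etaL cLH)
  (compat_coalg_L : compat_coalgebra_l DeltaL epsL cLH)
  (compat_alg_H : compat_algebra_r muH etaH cLH)
  (compat_coalg_H : compat_coalgebra_r DeltaH epsH cLH) :
  let mu : hom ((H ⊗ L) ⊗ (H ⊗ L)) (H ⊗ L) :=
    (muH ⊗₁ muL) ∘ middle H L cLH in
  let eta : hom munit (H ⊗ L) := (etaH ⊗₁ etaL) ∘ lunit⁻¹ in
  let Delta : hom (H ⊗ L) ((H ⊗ L) ⊗ (H ⊗ L)) :=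
    middle H L (cLH⁻¹) ∘ (DeltaH ⊗₁ DeltaL) in
  let eps : hom (H ⊗ L) munit := lunit ∘ (epsH ⊗₁ epsL) in
  let c : hom ((H ⊗ L) ⊗ (H ⊗ L)) ((H ⊗ L) ⊗ (H ⊗ L)) :=
    middle H L (cLH⁻¹) ∘ (cH ⊗₁ cL) ∘ middle H L cLH in
  is_braided_bialgebra mu eta Delta eps c /\
  (forall (SH : hom H H) (SL : hom L L),
    is_braided_Hopf_algebra muH etaH DeltaH epsH cH SH ->
    is_braided_Hopf_algebra muL etaL DeltaL epsL cL SL ->
    is_braided_Hopf_algebra mu eta Delta eps c (SH ⊗₁ SL)).
Proof.
  intros mu eta Delta eps c.
  pose proof (@hopf_transfer C H L muH etaH DeltaH epsH cH
    muL etaL DeltaL epsL cL cLH braid_LLH braid_LHH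
    compat_alg_L compat_coalg_L compat_alg_H compat_coalg_H) as transfer.
  assert (bialg : is_braided_bialgebra mu eta Delta eps c).
  (* The bialgebra axioms do not mention an antipode, so identities, which always slide, interpret
     that generator. *)
  { specialize (transfer (id H) (id L) (slides_id _) (slides_id _)).
    destruct bialgH as [[h1 [h2 h3]] [h4 [h5 h6]] h7 h8 [h9 h10] [h11 h12]
      [h13 h14] [h15 h16] [h17 h18] [h19 h20] h21].
    destruct bialgL as [[l1 [l2 l3]] [l4 [l5 l6]] l7 l8 [l9 l10] [l11 l12]
      [l13 l14] [l15 l16] [l17 l18] [l19 l20] l21].
    repeat split.
    - by_transfer transfer h1 l1.
    - by_transfer transfer h2 l2.
    - by_transfer transfer h3 l3.
    - by_transfer transfer h4 l4.
    - by_transfer transfer h5 l5.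
    - by_transfer transfer h6 l6.
    (* Invertibility of the braid is not an equation between terms and is checked factor by
       factor. *)
    - apply is_iso_comp; [apply is_iso_comp|].
      + apply is_iso_middle, is_iso_inv.
      + now apply is_iso_tensor.
      + apply is_iso_middle, is_iso_hom.
    - by_transfer transfer h8 l8.
    - by_transfer transfer h9 l9.
    - by_transfer transfer h10 l10.
    - by_transfer transfer h11 l11.
    - by_transfer transfer h12 l12.
    - by_transfer transfer h13 l13.
    - by_transfer transfer h14 l14.
    - by_transfer transfer h15 l15.
    - by_transfer transfer h16 l16.
    - by_transfer transfer h17 l17.
    - by_transfer transfer h18 l18.
    - by_transfer transfer h19 l19.
    - by_transfer transfer h20 l20.
    - by_transfer transfer h21 l21. }
  split; [exact bialg|].
  intros SH SL [_ antiH] [_ antiL]; split; [exact bialg|].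
  specialize (transfer SH SL).
  pose proof (antipode_slides_l (bb_algebra bialgL) (bb_coalgebra bialgL)
    compat_alg_L compat_coalg_L antiL) as slideL.
  pose proof (antipode_slides_r (bb_algebra bialgH) (bb_coalgebra bialgH)
    compat_alg_H compat_coalg_H antiH) as slideH.
  specialize (transfer slideL slideH).
  destruct antiH as [h1 h2], antiL as [l1 l2].
  split.
  - by_transfer transfer h1 l1.
  - by_transfer transfer h2 l2.
Qed.
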